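(* (1) If $R$ is a ring (possibly non-commutative), $r\in R$ and $rR$ has a serial factorization, then $r$ is contained in only a finite number of maximal right ideals of $R$ and each prime ideal $P$ of $R$ with $r\in P$ is contained in a unique maximal right ideal of $R$. (2) A commutative integral domain $R$ has the property that every non-zero ideal has a serial factorization if and only if $R$ is an $h$-local Pr\''ufer domain.
   Context: Rings are associative with identity $1\neq 0$, not necessarily commutative. The product $IJ$ of two right ideals is the set of finite sums of products $xy$ with $x\in I$, $y\in J$. A right module is uniserial if its lattice of submodules is linearly ordered by inclusion. A finite family $\{A_1,\dots,A_n\}$ of proper right ideals of $R$ is coindependent if $A_i+\bigcap_{j\neq i}A_j=R$ for every $i$ (an empty intersection being $R$). A serial factorization of a right ideal $A$ of $R$ is a factorization $A=A_1\cdots A_n$ where $A_1,\dots,A_n$ are proper right ideals of $R$ forming a coindependent family, $A_iA_j=A_jA_i$ for all $i,j$, and $R/A_i$ is a uniserial right $R$-module for every $i$. The improper ideal $R$ is regarded as having the empty serial factorization ($n=0$). A commutative integral domain $S$ is $h$-local if each non-zero element of $S$ is contained in only a finite number of maximal ideals of $S$ and each non-zero prime ideal of $S$ is contained in only one maximal ideal of $S$. A Pr\''ufer domain is a commutative integral domain $R$ such that the localization $R_M$ is a valuation domain for every maximal ideal $M$ of $R$. *)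

(* Defs.v *)
From HB Require Import structures.
From mathcomp Require Import all_boot all_order all_algebra.
From mathcomp Require Import generic_quotient ring_quotient fraction.
From mathcomp Require Import boolp classical_sets cardinality.

Set Implicit Arguments.
Unset Strict Implicit.
Unset Printing Implicit Defensive.

Import GRing.Theory.
Local Open Scope ring_scope.
Local Open Scope quotient_scope.
Local Open Scope classical_set_scope.

Section Ideals.
Variable R : nzRingType.
Implicit Types I J P M : set R.

(* Closure under opposites follows from closure under right multiplication
   by -1. *)
Definition right_ideal I :=
  [/\ I 0, forall x y, I x -> I y -> I (x + y)
    & forall x a, I x -> I (x * a)].

Definition ideal I := right_ideal I /\ forall a x, I x -> I (a * x).

Definition is_proper I := I <> setT.

Definition ideal_add I J : set R := [set x + y | x in I & y in J].

Definition ideal_mul I J : set R :=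
  [set z | exists2 s : seq (R * R),
     forall p, p \in s -> I p.1 /\ J p.2 & z = \sum_(p <- s) p.1 * p.2].

Definition right_principal (r : R) : set R := [set r * x | x in setT].

Definition maximal_among (C : set (set R)) M :=
  [/\ C M, is_proper M & forall J, C J -> is_proper J -> M `<=` J -> J = M].

Definition maximal_right_ideal := maximal_among right_ideal.

Definition maximal_ideal := maximal_among ideal.

Definition prime_ideal P :=
  [/\ ideal P, is_proper P
    & forall I J, ideal I -> ideal J -> ideal_mul I J `<=` P ->
        I `<=` P \/ J `<=` P].

End Ideals.

Definition uniserial (S : nzRingType) (M : lmodType S) :=
  forall N1 N2 : set M,
    GRing.submod_closed [in N1] -> GRing.submod_closed [in N2] ->
    N1 `<=` N2 \/ N2 `<=` N1.

Record rideal (R : nzRingType) := Rideal {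
  rideal_set :> set R;
  ridealP : right_ideal rideal_set }.

Section RightQuotient.
Variables (R : nzRingType) (A : rideal R).

Definition rideal_mem (x : R) : bool := x \in rideal_set A.

Lemma rideal_memP x : reflect (rideal_set A x) (rideal_mem x).
Proof. by apply: (iffP idP) => [/set_mem|/mem_set]. Qed.

Lemma rideal_mem_zmod_closed : zmod_closed rideal_mem.
Proof.
have [A0 AD AM] := ridealP A; split; first exact/rideal_memP.
move=> x y /rideal_memP Ax /rideal_memP Ay; apply/rideal_memP.
by apply: AD => //; rewrite -mulrN1; apply: AM.
Qed.

HB.instance Definition _ :=
  GRing.isZmodClosed.Build R rideal_mem rideal_mem_zmod_closed.

Definition rideal_zmod : zmodClosed R :=
  GRing.ZmodClosed.clone R rideal_mem _.

(* The right R-module R/A.  Right R-modules are left modules over the converse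
   ring R^c, a acting on x + A by (x + A)a = xa + A. *)
Definition right_quot := {ideal_quot rideal_zmod}.

HB.instance Definition _ := GRing.Zmodule.on right_quot.

Definition right_quot_pi (x : R) : right_quot := \pi_{ideal_quot rideal_zmod} x.

Definition right_quot_scale (a : R^c) (u : right_quot) : right_quot :=
  right_quot_pi (repr (u : {ideal_quot rideal_zmod}) * (a : R)).

Lemma right_quot_pi_surj (u : right_quot) : exists x, u = right_quot_pi x.
Proof.
by exists (repr (u : {ideal_quot rideal_zmod})); rewrite /right_quot_pi reprK.
Qed.

Lemma right_quot_pi_eq x y : right_quot_pi x = right_quot_pi y <->
  rideal_set A (x - y).
Proof.
have E : rideal_mem (x - y) = (right_quot_pi x == right_quot_pi y).
  exact: (Quotient.idealrBE rideal_zmod).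
by split=> [/eqP|/rideal_memP]; rewrite ?E; [rewrite -E => /rideal_memP|move/eqP].
Qed.

Lemma right_quot_piD x y :
  right_quot_pi (x + y) = right_quot_pi x + right_quot_pi y.
Proof. exact: raddfD. Qed.

Lemma right_quot_scaleE (a x : R) :
  right_quot_scale a (right_quot_pi x) = right_quot_pi (x * a).
Proof.
have [_ _ AM] := ridealP A.
apply/right_quot_pi_eq; rewrite -mulrBl; apply/AM/right_quot_pi_eq.
exact: reprK.
Qed.

Fact right_quot_scalerA (a b : R^c) (u : right_quot) :
  right_quot_scale a (right_quot_scale b u) = right_quot_scale (a * b) u.
Proof.
by have [x ->] := right_quot_pi_surj u; rewrite !right_quot_scaleE -mulrA.
Qed.

Fact right_quot_scale1r : left_id (1 : R^c) right_quot_scale.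
Proof.
by move=> u; have [x ->] := right_quot_pi_surj u; rewrite right_quot_scaleE mulr1.
Qed.

Fact right_quot_scalerDr : right_distributive right_quot_scale +%R.
Proof.
move=> a u v.
have [x ->] := right_quot_pi_surj u; have [y ->] := right_quot_pi_surj v.
by rewrite -right_quot_piD !right_quot_scaleE mulrDl right_quot_piD.
Qed.

Fact right_quot_scalerDl (u : right_quot) :
  {morph right_quot_scale^~ u : a b / a + b}.
Proof.
move=> a b; have [x ->] := right_quot_pi_surj u.
by rewrite !right_quot_scaleE mulrDr right_quot_piD.
Qed.

HB.instance Definition _ := GRing.Zmodule_isLmodule.Build R^c right_quot
  right_quot_scalerA right_quot_scale1r right_quot_scalerDr
  right_quot_scalerDl.

Lemma right_quot_piZ (a x : R) :
  (a : R^c) *: (right_quot_pi x : right_quot) = right_quot_pi (x * a).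
Proof. exact: right_quot_scaleE. Qed.

End RightQuotient.

Section SerialFactorization.
Variable R : nzRingType.

Definition coindependent n (A : 'I_n -> rideal R) :=
  (forall i, is_proper (A i)) /\
  forall i, ideal_add (A i) (\bigcap_(j in [set j | j != i]) A j) = setT.

(* The iterated product is A_1 (A_2 ( ... (A_n R))), which is the product
   A_1 ... A_n since A_n R = A_n, and is R when n = 0. *)
Definition serial_factorization (B : set R) n (A : 'I_n -> rideal R) :=
  [/\ B = \big[@ideal_mul R/setT]_(i < n) (A i : set R),
      coindependent A,
      forall i j, ideal_mul (A i) (A j) = ideal_mul (A j) (A i)
    & forall i, @uniserial R^c (right_quot (A i))].

Definition has_serial_factorization (B : set R) :=
  exists n (A : 'I_n -> rideal R), serial_factorization B A.

End SerialFactorization.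

Definition h_local (R : idomainType) :=
  (forall x : R, x != 0 -> finite_set [set M | maximal_ideal M /\ M x]) /\
  (forall P : set R, prime_ideal P -> P <> [set 0] ->
     exists! M : set R, maximal_ideal M /\ P `<=` M).

(* V is a valuation domain with field of fractions K. *)
Definition valuation_domain (K : fieldType) (V : set K) :=
  GRing.subring_closed [in V] /\ forall x : K, x != 0 -> V x \/ V x^-1.

(* R_M, as a subring of the field of fractions of R (which is also the field
   of fractions of R_M). *)
Definition localization (R : idomainType) (M : set R) : set {fraction R} :=
  [set x | exists a s : R, ~ M s /\ x = tofrac a / tofrac s].

Definition prufer_domain (R : idomainType) :=
  forall M : set R, maximal_ideal M -> valuation_domain (localization M).

(* Main.v *)
(* If AB = BA and A + B = R, then A is two-sided. So in a serial factorization
   rR = A_1 ... A_n with n > 1 all A_i are two-sided, and a prime P containing r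
   contains some A_i; a maximal right ideal containing r does so for any n.
   Since R/A_i is uniserial, A_i lies in a unique maximal right ideal.

   In a domain, a factorization of abR makes a and b comparable in each R_M.
   When R is an h-local Pruefer domain, I is the product of the contractions to
   R of the I R_M, for M among the finitely many maximal ideals containing I: by
   h-locality such a contraction lies in no maximal ideal other than M. *)
Require Import Defs.
From mathcomp Require Import all_boot all_order all_algebra.
From mathcomp Require Import generic_quotient fraction ring.
From mathcomp Require Import boolp classical_sets cardinality.

Set Implicit Arguments.
Unset Strict Implicit.
Unset Printing Implicit Defensive.
Local Open Scope ring_scope.
Local Open Scope classical_set_scope.

Import GRing.Theory.

Section RightIdeals.
Variable R : nzRingType.
Implicit Types I J P M : set R.

Lemma right_ideal_sub1 I : right_ideal I -> I 1 -> I = setT.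
Proof.
by move=> [_ _ IM] I1; apply/seteqP; split=> // x _; rewrite -[x]mul1r; apply: IM.
Qed.

Lemma right_ideal_proper I : right_ideal I -> is_proper I <-> ~ I 1.
Proof.
move=> rI; split=> [+ I1|+ IT]; first by apply; apply: right_ideal_sub1.
by apply; rewrite IT.
Qed.

Lemma right_principal_right_ideal (r : R) : right_ideal (right_principal r).
Proof.
split; first by exists 0; rewrite ?mulr0.
  by move=> _ _ [x _ <-] [y _ <-]; exists (x + y); rewrite ?mulrDr.
by move=> _ a [x _ <-]; exists (x * a); rewrite ?mulrA.
Qed.

Lemma right_principal_id (r : R) : right_principal r r.
Proof. by exists 1; rewrite ?mulr1. Qed.

Lemma right_principal_sub I r : right_ideal I -> I r -> right_principal r `<=` I.
Proof. by move=> [_ _ IM] Ir _ [x _ <-]; apply: IM. Qed.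

Lemma ideal_add_right_ideal I J :
  right_ideal I -> right_ideal J -> right_ideal (ideal_add I J).
Proof.
move=> [I0 ID IM] [J0 JD JM]; split.
- by exists 0 => //; exists 0; rewrite ?addr0.
- move=> _ _ [x Ix [y Jy <-]] [x' Ix' [y' Jy' <-]].
  exists (x + x'); first exact: ID.
  by exists (y + y'); [apply: JD | rewrite addrACA].
- move=> _ a [x Ix [y Jy <-]]; exists (x * a); first exact: IM.
  by exists (y * a); [apply: JM | rewrite mulrDl].
Qed.

Lemma ideal_add_subl I J : J 0 -> I `<=` ideal_add I J.
Proof. by move=> J0 x Ix; exists x => //; exists 0; rewrite ?addr0. Qed.

Lemma ideal_add_subr I J : I 0 -> J `<=` ideal_add I J.
Proof. by move=> I0 x Jx; exists 0 => //; exists x; rewrite ?add0r. Qed.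

Lemma ideal_mulr I J x y : I x -> J y -> ideal_mul I J (x * y).
Proof.
move=> Ix Jy; exists [:: (x, y)]; last by rewrite big_seq1.
by move=> p; rewrite inE => /eqP ->.
Qed.

Lemma ideal_mul_sub I J M : M 0 -> (forall x y, M x -> M y -> M (x + y)) ->
  (forall x y, I x -> J y -> M (x * y)) -> ideal_mul I J `<=` M.
Proof.
move=> M0 MD IJM _ [s sIJ ->]; rewrite big_seq.
by apply: big_ind => // p /sIJ [Ip Jp]; apply: IJM.
Qed.

Lemma ideal_mul_right_ideal I J :
  right_ideal J -> right_ideal (ideal_mul I J).
Proof.
move=> [_ _ JM]; split.
- by exists [::]; rewrite ?big_nil.
- move=> _ _ [s sIJ ->] [t tIJ ->]; exists (s ++ t); last by rewrite big_cat.
  by move=> p; rewrite mem_cat => /orP[/sIJ|/tIJ].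
- move=> _ a [s sIJ ->]; exists [seq (p.1, p.2 * a) | p <- s].
    by move=> _ /mapP[p /sIJ [Ip Jp] ->]; split=> //=; apply: JM.
  by rewrite big_map mulr_suml; apply: eq_bigr => p _; rewrite mulrA.
Qed.

Lemma ideal_mul_ideal I J : ideal I -> ideal J -> ideal (ideal_mul I J).
Proof.
move=> [rI lI] [rJ lJ]; split; first exact: ideal_mul_right_ideal.
move=> a _ [s sIJ ->]; exists [seq (a * p.1, p.2) | p <- s].
  by move=> _ /mapP[p /sIJ [Ip Jp] ->]; split=> //=; apply: lI.
by rewrite big_map mulr_sumr; apply: eq_bigr => p _; rewrite mulrA.
Qed.

Lemma big_ideal_mul_ideal (T : Type) (s : seq T) (F : T -> set R) :
  (forall i, ideal (F i)) -> ideal (\big[@ideal_mul R/setT]_(i <- s) F i).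
Proof. by move=> iF; apply: big_ind => //; exact: ideal_mul_ideal. Qed.

Lemma bigcap_right_ideal (T : Type) (D : set T) (F : T -> set R) :
  (forall i, right_ideal (F i)) -> right_ideal (\bigcap_(i in D) F i).
Proof.
move=> rF; split=> [i _|x y Fx Fy i Di|x a Fx i Di];
    have [F0 FD FM] := rF i => //.
  by apply: FD; [apply: Fx | apply: Fy].
by apply/FM/Fx.
Qed.

Lemma bigcup_right_ideal (F : set (set R)) : F !=set0 ->
  (forall I, F I -> right_ideal I) -> total_on F subset ->
  right_ideal (\bigcup_(I in F) I).
Proof.
move=> [I FI] rF totF; split.
- by exists I => //; have [] := rF _ FI.
- move=> x y [J FJ Jx] [K FK Ky].
  have [JK|KJ] := totF _ _ FJ FK.
    by exists K => //; have [_ KD _] := rF _ FK; apply: KD => //; apply: JK.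
  by exists J => //; have [_ JD _] := rF _ FJ; apply: JD => //; apply: KJ.
- by move=> x a [J FJ Jx]; exists J => //; have [_ _ JM] := rF _ FJ; apply: JM.
Qed.

Lemma maximal_right_ideal_comax M I x : maximal_right_ideal M ->
  right_ideal I -> I x -> ~ M x -> ideal_add I M = setT.
Proof.
move=> [rM pM maxM] rI Ix Mx; apply: contrapT => pIM.
have [I0 _ _] := rI; have [M0 _ _] := rM.
have EM : ideal_add I M = M.
  by apply: maxM => //; [exact: ideal_add_right_ideal | exact: ideal_add_subr].
by apply: Mx; rewrite -EM; apply: ideal_add_subl.
Qed.

(* If 1 = a + m with a in I and m in M, then y = ay + my for y in J. *)
Lemma maximal_right_ideal_mul M I J : maximal_right_ideal M -> right_ideal I ->
  ideal_mul I J `<=` M -> I `<=` M \/ J `<=` M.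
Proof.
move=> maxM rI IJM; have [[x [Ix Mx]]|noI] := pselect (exists x, I x /\ ~ M x).
  right=> y Jy; have [[M0 MD MM] _ _] := maxM.
  have: ideal_add I M 1 by rewrite (maximal_right_ideal_comax maxM rI Ix Mx).
  move=> [a Ia [m Mm am]]; rewrite -[y]mul1r -am mulrDl.
  by apply: MD; [apply/IJM/ideal_mulr | apply: MM].
by left=> x Ix; apply: contrapT => Mx; apply: noI; exists x.
Qed.

Lemma maximal_right_ideal_big (T : Type) (s : seq T) (F : T -> set R) M :
  maximal_right_ideal M -> (forall i, right_ideal (F i)) ->
  \big[@ideal_mul R/setT]_(i <- s) F i `<=` M -> exists i, F i `<=` M.
Proof.
move=> maxM rF; elim: s => [|i s IH]; rewrite ?big_nil ?big_cons.
  by move=> TM; have [_ pM _] := maxM; case: pM; apply/seteqP; split.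
by move=> /(maximal_right_ideal_mul maxM (rF i)) [?|/IH]; first exists i.
Qed.

Lemma prime_ideal_big (T : Type) (s : seq T) (F : T -> set R) P :
  prime_ideal P -> (forall i, ideal (F i)) ->
  \big[@ideal_mul R/setT]_(i <- s) F i `<=` P -> exists i, F i `<=` P.
Proof.
move=> [_ pP primeP] iF; elim: s => [|i s IH]; rewrite ?big_nil ?big_cons.
  by move=> TP; case: pP; apply/seteqP; split.
by move=> /(primeP _ _ (iF i) (big_ideal_mul_ideal _ iF)) [?|/IH]; first exists i.
Qed.

Lemma uniserial_right_quotP (A : rideal R) :
  @uniserial R^c (right_quot A) <->
  forall I J, right_ideal I -> right_ideal J -> A `<=` I -> A `<=` J ->
    I `<=` J \/ J `<=` I.
Proof.
split=> [uA I J rI rJ AI AJ|uA N1 N2 sN1 sN2].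
  have closed K : right_ideal K ->
      GRing.submod_closed [in (@right_quot_pi R A) @` K].
    move=> [K0 KD KM]; split.
      apply/mem_set; exists 0 => //; exact: raddf0.
    move=> a _ _ /set_mem[x Kx <-] /set_mem[y Ky <-]; apply/mem_set.
    exists (x * a + y); first by apply: KD => //; apply: KM.
    by rewrite right_quot_piD right_quot_piZ.
  have pi_sub K L : right_ideal L -> A `<=` L ->
      (@right_quot_pi R A) @` K `<=` (@right_quot_pi R A) @` L -> K `<=` L.
    move=> [_ LD _] AL sKL x Kx.
    have [|y Ly /esym/right_quot_pi_eq Axy] := sKL (@right_quot_pi R A x).
      by exists x.
    by rewrite -(subrK y x); apply: LD => //; apply: AL.
  by case: (uA _ _ (closed _ rI) (closed _ rJ)) => ?; [left|right]; apply: pi_sub.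
have pi_closed N : GRing.submod_closed [in N] ->
    right_ideal ((@right_quot_pi R A) @^-1` N) /\
    A `<=` (@right_quot_pi R A) @^-1` N.
  move=> [/set_mem N0 Nlin].
  have NM (a : R^c) (u : right_quot A) : N u -> N (a *: u).
    move=> Nu; rewrite -[_ *: _]addr0; apply/set_mem/Nlin; exact/mem_set.
  have ND (u v : right_quot A) : N u -> N v -> N (u + v).
    move=> Nu Nv; rewrite -[u]scale1r; apply/set_mem/Nlin; exact/mem_set.
  have N0' : N (right_quot_pi A 0).
    by have -> : right_quot_pi A 0 = 0 by exact: raddf0.
  split; first split=> //=.
  - by move=> x y Nx Ny; rewrite right_quot_piD; apply: ND.
  - by move=> x a Nx; rewrite -right_quot_piZ; apply: NM.
  move=> x Ax /=; have -> : right_quot_pi A x = right_quot_pi A 0 => //.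
  by apply/right_quot_pi_eq; rewrite subr0.
have [[r1 A1] [r2 A2]] := (pi_closed _ sN1, pi_closed _ sN2).
have pi_sub N N' : (@right_quot_pi R A) @^-1` N `<=` (@right_quot_pi R A) @^-1` N'
    -> N `<=` N'.
  by move=> sNN' u; have [x ->] := right_quot_pi_surj u; apply: sNN'.
by case: (uA _ _ r1 r2 A1 A2) => ?; [left|right]; apply: pi_sub.
Qed.

Lemma uniserial_maximal_right_ideal (A : rideal R) :
  is_proper A -> @uniserial R^c (right_quot A) ->
  exists! M, maximal_right_ideal M /\ A `<=` M.
Proof.
move=> pA /uniserial_right_quotP uA.
pose F : set (set R) := [set I | [/\ right_ideal I, is_proper I & A `<=` I]].
have FA : F A by split=> //; apply: ridealP.
have rU : right_ideal (\bigcup_(I in F) I).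
  apply: bigcup_right_ideal; first by exists A.
    by move=> I [].
  by move=> I J [? _ ?] [? _ ?]; apply: uA.
have subU I : right_ideal I -> is_proper I -> A `<=` I ->
    I `<=` \bigcup_(I in F) I.
  by move=> *; apply: bigcup_sup.
have pU : is_proper (\bigcup_(I in F) I).
  apply/(right_ideal_proper rU) => -[I [rI pI _]].
  by move/(right_ideal_proper rI) : pI.
have AU : A `<=` \bigcup_(I in F) I by move=> x Ax; exists A.
exists (\bigcup_(I in F) I); split.
  split=> //; split=> // J rJ pJ UJ; apply/seteqP; split=> //.
  by apply: subU => //; apply: subset_trans UJ.
by move=> M [[rM pM maxM] AM]; apply: maxM => //; apply: subU.
Qed.

Lemma coindependent_comax n (A : 'I_n -> rideal R) i j :
  coindependent A -> i != j -> ideal_add (A i) (A j) = setT.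
Proof.
move=> [_ coA] ij; apply/seteqP; split=> // x _.
have: ideal_add (A i) (\bigcap_(j in [set j | j != i]) A j) x by rewrite coA.
move=> [a Aa [b Ab <-]]; exists a => //; exists b => //.
by apply: Ab; rewrite /= eq_sym.
Qed.

(* R A = (A + B) A = A A + A B is contained in A because A B = B A. *)
Lemma comax_commute_ideal I J : right_ideal I -> ideal_add I J = setT ->
  ideal_mul I J = ideal_mul J I -> ideal I.
Proof.
move=> rI coIJ cIJ; split=> // c x Ix; have [I0 ID IM] := rI.
have: ideal_add I J c by rewrite coIJ.
move=> [a Ia [b Jb <-]]; rewrite mulrDl; apply: (ID); first exact: (IM).
have: ideal_mul I J (b * x) by rewrite cIJ; apply: ideal_mulr.
exact: (@ideal_mul_sub I J I I0 ID (fun u v Iu _ => IM u v Iu)).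
Qed.

Lemma prime_ideal_sub_serial_factor (r : R) n (A : 'I_n -> rideal R) :
  serial_factorization (right_principal r) A ->
  forall P, prime_ideal P -> P r -> exists i, A i `<=` P.
Proof.
move=> [prodA coA cA _] P primeP Pr.
have PA : \big[@ideal_mul R/setT]_(i < n) (A i : set R) `<=` P.
  by rewrite -prodA; apply: right_principal_sub => //; have [[]] := primeP.
have [n_le1|n_gt1] := leqP n 1.
  case: n n_le1 A prodA PA {coA cA} => [_ A _|[|//] _ A prodA _].
    rewrite big_ord0 => TP; have [_ pP _] := primeP; case: pP.
    by apply/seteqP; split.
  exists ord0 => x Ax; have [[rP _] _ _] := primeP.
  apply: (right_principal_sub rP Pr); rewrite prodA big_ord_recl big_ord0.
  by rewrite -[x]mulr1; apply: ideal_mulr.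
apply: (prime_ideal_big primeP _ PA) => i.
have [j ij] : exists j, i != j.
  have n_gt0 : (0 < n)%N by apply: leq_trans n_gt1.
  have [->|i0] := eqVneq i (Ordinal n_gt0); first by exists (Ordinal n_gt1).
  by exists (Ordinal n_gt0).
exact: comax_commute_ideal (ridealP _) (coindependent_comax coA ij) (cA i j).
Qed.

Lemma finite_maximal_right_ideals (r : R) :
  has_serial_factorization (right_principal r) ->
  finite_set [set M : set R | maximal_right_ideal M /\ M r].
Proof.
move=> [n [A [prodA [pA _] _ uA]]].
have mA i := uniserial_maximal_right_ideal (pA i) (uA i).
pose f i := sval (cid (mA i)).
apply: (@sub_finite_set _ _ (f @` setT)); last exact/finite_image/finite_finset.
move=> M [maxM Mr].
have [||i AiM] := @maximal_right_ideal_big _ (index_enum 'I_n) A M maxM.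
- by move=> i; apply: ridealP.
- by rewrite -prodA; apply: right_principal_sub => //; have [] := maxM.
exists i => //; by rewrite /f; case: cid => /= N [_]; apply.
Qed.

Lemma prime_unique_maximal_right_ideal r P :
  has_serial_factorization (right_principal r) -> prime_ideal P -> P r ->
  exists! M, maximal_right_ideal M /\ P `<=` M.
Proof.
move=> [n [A sA]] primeP Pr.
have [i AiP] := prime_ideal_sub_serial_factor sA primeP Pr.
have [_ [pA _] _ uA] := sA.
have [M [[maxM AiM] uniqM]] := uniserial_maximal_right_ideal (pA i) (uA i).
have [[rP _] pP _] := primeP; have [rM pM MM] := maxM.
exists M; split; last by move=> N [maxN PN]; apply: uniqM; split=> // x /AiP /PN.
split=> //.
have /uniserial_right_quotP := uA i.
move=> /(_ P M rP rM AiP AiM) [//|MP].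
by rewrite (MM P).
Qed.

End RightIdeals.

Section CommutativeRings.
Variable R : comNzRingType.
Implicit Types I J P M S : set R.

Lemma right_idealE : @right_ideal R = @ideal R.
Proof.
apply/funext => I; apply/propext; split=> [rI|[]//]; split=> // a x Ix.
by rewrite mulrC; have [_ _ IM] := rI; apply: IM.
Qed.

Lemma maximal_right_idealE : @maximal_right_ideal R = @maximal_ideal R.
Proof. by rewrite /maximal_right_ideal right_idealE. Qed.

Lemma maximal_ideal_mul M x y :
  maximal_ideal M -> ~ M x -> ~ M y -> ~ M (x * y).
Proof.
rewrite -maximal_right_idealE => maxM Mx My Mxy; have [[M0 MD MM] _ _] := maxM.
have: ideal_add (right_principal x) M 1.
  by rewrite (maximal_right_ideal_comax maxM (right_principal_right_ideal x)
    (@right_principal_id _ x) Mx).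
move=> [_ [a _ <-] [m Mm E]]; apply: My; rewrite -[y]mulr1 -E mulrDr.
by apply: MD; [rewrite mulrCA mulrA; apply: MM | rewrite mulrC; apply: MM].
Qed.

Lemma maximal_ideal1 M : maximal_ideal M -> ~ M 1.
Proof. by move=> [[rM _] pM _]; apply/(right_ideal_proper rM). Qed.

Lemma exists_ideal_avoiding I S : ideal I -> I `&` S = set0 ->
  exists P, [/\ ideal P, I `<=` P, P `&` S = set0 &
    forall J, ideal J -> P `<=` J -> J `&` S = set0 -> J = P].
Proof.
rewrite -right_idealE => rI IS.
have [F FC totF|X [[rX XS] maxX]] :=
    @Zorn_bigcup R [set X | right_ideal (I `|` X) /\ (I `|` X) `&` S = set0].
  rewrite /=; have -> : (I `|` \bigcup_(X in F) X) =
      \bigcup_(J in I |` [set I `|` X | X in F]) J.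
    apply/seteqP; split=> [x [Ix|[X FX Xx]]|x [J [->|[X FX <-]]]].
    - by exists I => //; left.
    - by exists (I `|` X); [right; exists X | right].
    - by left.
    - by move=> [Ix|Xx]; [left | right; exists X].
  split.
    apply: bigcup_right_ideal; first by exists I; left.
      by move=> J [->//|[X /FC[rX _] <-]].
    move=> J K [->|[X FX <-]] [->|[Y FY <-]].
    - by left.
    - by left; apply: subsetUl.
    - by right; apply: subsetUl.
    - by case: (totF _ _ FX FY) => ?; [left|right]; apply: setUS.
  apply/seteqP; split=> // x [[J [->|[X /FC[_ XS] <-]] Jx] Sx].
    by rewrite -IS.
  by rewrite -XS.
exists (I `|` X); split=> // J rJ XJ JS; apply: contrapT => JX.
have IJ : I `|` J = J by apply/setUidr => x Ix; apply: XJ; left.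
apply: (maxX J); last by rewrite /= IJ.
split=> [x Xx|JsX]; first by apply: XJ; right.
by apply: JX; apply/seteqP; split=> // x /JsX; right.
Qed.

Lemma exists_maximal_ideal I : ideal I -> is_proper I ->
  exists2 M, maximal_ideal M & I `<=` M.
Proof.
move=> iI pI; have avoid1 J : ideal J -> is_proper J <-> J `&` [set 1] = set0.
  move=> [rJ _]; rewrite (right_ideal_proper rJ); split=> [J1|J1 J1'].
    by apply/seteqP; split=> // x [Jx x1]; apply: J1; rewrite -x1.
  suff: (J `&` [set 1]) 1 by rewrite J1.
  by split.
have [M [iM IM M1 maxM]] := exists_ideal_avoiding iI ((avoid1 _ iI).1 pI).
exists M => //; split=> //; first exact/(avoid1 _ iM).
by move=> J iJ pJ MJ; apply: maxM => //; apply/(avoid1 _ iJ).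
Qed.

Lemma exists_prime_ideal_avoiding I S : ideal I -> S 1 ->
  (forall s t, S s -> S t -> S (s * t)) -> I `&` S = set0 ->
  exists P, [/\ prime_ideal P, I `<=` P & P `&` S = set0].
Proof.
move=> iI S1 SM IS; have [P [iP IP PS maxP]] := exists_ideal_avoiding iI IS.
have [rP _] := iP; have [P0 PD PM] := rP.
have meetS x : ~ P x -> exists p a, P p /\ S (p + x * a).
  move=> Px; apply: contrapT => noS; apply: Px.
  have rPx : right_ideal (ideal_add P (right_principal x)).
    exact: ideal_add_right_ideal (right_principal_right_ideal x).
  have [Px0 _ _] := right_principal_right_ideal x.
  rewrite -(maxP (ideal_add P (right_principal x))); first last.
  - apply/seteqP; split=> // y [[p Pp [_ [a _ <-] <-]] Sy]; apply: noS.
    by exists p, a.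
  - exact: ideal_add_subl.
  - by rewrite -right_idealE.
  exact/(ideal_add_subr P0)/right_principal_id.
exists P; split=> //; split=> // [PT|J K [rJ lJ] [rK lK] JKP].
  suff: (P `&` S) 1 by rewrite PS.
  by rewrite PT.
apply: contrapT => /not_orP[/nonsubset[x [Jx Px]] /nonsubset[y [Ky Py]]].
have [p [a [Pp Sp]]] := meetS _ Px; have [q [b [Pq Sq]]] := meetS _ Py.
suff: (P `&` S) ((p + x * a) * (q + y * b)) by rewrite PS.
split; last exact: SM.
rewrite mulrDl; apply: (PD); first exact: (PM).
rewrite mulrDr; apply: (PD); first by rewrite mulrC; apply: (PM).
have [[_ _ JM] [_ _ KM]] := (rJ, rK).
by apply/JKP/ideal_mulr; [apply: (JM) | apply: (KM)].
Qed.

Lemma prod_bigcap_coindependent (T : eqType) (s : seq T) (F : T -> set R) :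
  (forall i, right_ideal (F i)) -> uniq s ->
  (forall i, ideal_add (F i) (\bigcap_(j in [set j | j != i]) F j) = setT) ->
  \big[@ideal_mul R/setT]_(i <- s) F i = \bigcap_(i in [set` s]) F i.
Proof.
move=> rF + coF; elim: s => [_|i s IH /= /andP[i_s uniq_s]].
  by rewrite big_nil; apply/seteqP; split=> // x _ i.
rewrite big_cons IH //; apply/seteqP; split=> x; last first.
  move=> Fx; rewrite -[x]mul1r.
  have: ideal_add (F i) (\bigcap_(j in [set j | j != i]) F j) 1 by rewrite coF.
  move=> [a Fa [b Fb <-]]; rewrite mulrDl [b * x]mulrC.
  have [_ + _] : right_ideal (ideal_mul (F i) (\bigcap_(j in [set` s]) F j)).
    exact/ideal_mul_right_ideal/bigcap_right_ideal.
  apply; apply: ideal_mulr => //.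
  - by move=> j js; apply: Fx; rewrite /= inE js orbT.
  - by apply: Fx; rewrite /= inE eqxx.
  - by move=> j js; apply: Fb; apply: contraNneq i_s => <-.
have [F0 FD FM] := rF i.
have [G0 GD GM] : right_ideal (\bigcap_(j in [set` s]) F j).
  exact: bigcap_right_ideal.
move=> Fx j /=; rewrite inE => /predU1P[->|js].
  by apply: (ideal_mul_sub F0 FD) Fx => y z Fy _; apply: (FM).
suff: (\bigcap_(j in [set` s]) F j) x by apply.
by apply: (ideal_mul_sub G0 GD) Fx => y z _ Gz; rewrite mulrC; apply: (GM).
Qed.

Lemma serial_factorization_bigcap I n (A : 'I_n -> rideal R) :
  serial_factorization I A -> I = \bigcap_i (A i : set R).
Proof.
move=> [-> [_ coA] _ _]; rewrite prod_bigcap_coindependent ?index_enum_uniq //.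
  by apply: eq_bigcapl; split=> // i _ /=; rewrite mem_index_enum.
by move=> i; apply: ridealP.
Qed.

Lemma bigcap_serial_factorization n (A : 'I_n -> rideal R) :
  coindependent A -> (forall i, @uniserial R^c (right_quot (A i))) ->
  serial_factorization (\bigcap_i (A i : set R)) A.
Proof.
move=> [pA coA] uA; split=> // [|i j].
  rewrite prod_bigcap_coindependent ?index_enum_uniq //.
    by apply: eq_bigcapl; split=> // i _ /=; rewrite mem_index_enum.
  by move=> i; apply: ridealP.
have mulC I J : ideal_mul I J `<=` ideal_mul J I.
  move=> _ [s sIJ ->]; exists [seq (p.2, p.1) | p <- s].
    by move=> _ /mapP[p /sIJ [Ip Jp] ->].
  by rewrite big_map; apply: eq_bigr => p _; rewrite mulrC.
by apply/seteqP; split.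
Qed.

Lemma comax_maximal I J : right_ideal I -> right_ideal J ->
  (forall M, maximal_ideal M -> I `<=` M -> ~ J `<=` M) ->
  ideal_add I J = setT.
Proof.
move=> rI rJ IJM; apply: contrapT => pIJ.
have [I0 _ _] := rI; have [J0 _ _] := rJ.
have [|M maxM IJsM] := exists_maximal_ideal _ pIJ.
  by rewrite -right_idealE; apply: ideal_add_right_ideal.
apply: (IJM M maxM); apply: subset_trans IJsM.
  exact: ideal_add_subl.
exact: ideal_add_subr.
Qed.

Lemma bigcap_sub_maximal (T : eqType) (s : seq T) (F : T -> set R) M :
  maximal_ideal M -> (forall i, right_ideal (F i)) ->
  \bigcap_(i in [set` s]) F i `<=` M -> exists2 i, i \in s & F i `<=` M.
Proof.
move=> maxM rF FM; apply: contrapT => noF.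
suff: exists2 x, (\bigcap_(i in [set` s]) F i) x & ~ M x by move=> [x /FM].
elim: s noF {FM} => [_|i s IH noF]; first exists 1 => //.
  exact: maximal_ideal1.
have [|x Fx Mx] := IH.
  by move=> [j js FjM]; apply: noF; exists j; rewrite // inE js orbT.
have /nonsubset[y [Fy My]] : ~ F i `<=` M.
  by move=> FiM; apply: noF; exists i; rewrite ?mem_head.
exists (x * y); last exact: maximal_ideal_mul.
move=> j /=; rewrite inE => /predU1P[->|js]; have [_ _ FM] := rF j.
  by rewrite mulrC; have [_ _ FiM] := rF i; apply: FiM.
by apply: (FM); apply: Fx.
Qed.

End CommutativeRings.

Section Domains.
Variable R : idomainType.
Implicit Types I J P M : set R.

Lemma frac_divE (x : {fraction R}) :
  exists a b : R, b != 0 /\ x = tofrac a / tofrac b.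
Proof.
elim/quotW: x => x; exists \n_x, \d_x; split; first exact: denom_ratioP.
have d0 : tofrac \d_x != 0 by rewrite tofrac_eq0 denom_ratioP.
apply: (mulIf d0); rewrite divfK //.
change (FracField.mul (\pi_({fraction R}) x)%qT (tofrac \d_x) = tofrac \n_x).
rewrite !piE; apply/eqmodP; rewrite /= FracField.equivfE /FracField.mulf.
by rewrite !numden_Ratio ?mulf_neq0 ?oner_eq0 ?denom_ratioP // !mulr1 mulrC.
Qed.

Lemma tofrac_div_eq (a b c d : R) : b != 0 -> d != 0 ->
  tofrac a / tofrac b = tofrac c / tofrac d <-> a * d = c * b.
Proof.
move=> b0 d0; split=> [/eqP|E].
  by rewrite eqr_div ?tofrac_eq0 // -!tofracM tofrac_eq => /eqP.
by apply/eqP; rewrite eqr_div ?tofrac_eq0 // -!tofracM E.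
Qed.

Lemma localization_valuation_domainP M : maximal_ideal M ->
  valuation_domain (localization M) <->
  forall a b, a != 0 -> b != 0 ->
    exists s c, ~ M s /\ (s * a = b * c \/ s * b = a * c).
Proof.
move=> maxM; have [[[M0 MD MM] _] _ _] := maxM.
have neq0 s : ~ M s -> s != 0 by move=> Ms; apply: contra_notN Ms => /eqP ->.
split=> [[_ valM] a b a0 b0|compM].
  have ab0 : tofrac a / tofrac b != 0.
    by rewrite mulf_neq0 ?invr_eq0 ?tofrac_eq0.
  case: (valM _ ab0) => -[c [s [Ms]]].
    move=> /(tofrac_div_eq _ _ b0 (neq0 s Ms)) E; exists s, c; split=> //.
    by left; rewrite mulrC E mulrC.
  rewrite invf_div => /(tofrac_div_eq _ _ a0 (neq0 s Ms)) E.
  by exists s, c; split=> //; right; rewrite mulrC E mulrC.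
split; first split.
- apply/mem_set; exists 1, 1; split; first exact: maximal_ideal1.
  by rewrite tofrac1 divr1.
- move=> _ _ /set_mem[a [s [Ms ->]]] /set_mem[b [t [Mt ->]]]; apply/mem_set.
  exists (a * t - b * s), (s * t); split; first exact: maximal_ideal_mul.
  by rewrite -mulNr addf_div ?tofrac_eq0 ?neq0 // tofracB !tofracM mulNr.
- move=> _ _ /set_mem[a [s [Ms ->]]] /set_mem[b [t [Mt ->]]]; apply/mem_set.
  exists (a * b), (s * t); split; first exact: maximal_ideal_mul.
  by rewrite !tofracM mulf_div.
move=> x; have [a [b [b0 ->]]] := frac_divE x => ab0.
have a0 : a != 0 by apply: contraNneq ab0 => ->; rewrite tofrac0 mul0r.
have [s [c [Ms [E|E]]]] := compM _ _ a0 b0; [left|right]; exists c, s; split=> //.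
  by apply/(tofrac_div_eq _ _ b0 (neq0 s Ms)); rewrite mulrC E mulrC.
by rewrite invf_div; apply/(tofrac_div_eq _ _ a0 (neq0 s Ms)); rewrite mulrC E mulrC.
Qed.

(* Factor abR as A_1 ... A_n and let A_i lie in M.  If a = bt + c with c in A_i,
   then sc is in abR for some s in the remaining A_j and outside M, so that
   (s - bu)a = bst for some u. *)
Lemma has_serial_factorization_localization M a b : maximal_ideal M ->
  M a -> M b -> has_serial_factorization (right_principal (a * b)) ->
  exists s c, ~ M s /\ (s * a = b * c \/ s * b = a * c).
Proof.
move=> maxM Ma Mb [n [A sA]]; have prodA := serial_factorization_bigcap sA.
have [_ [_ coA] _ uA] := sA; have [[rM _] _ _] := maxM; have [_ MD MM] := rM.
have [i _ AiM] : exists2 i, i \in index_enum 'I_n & A i `<=` M.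
  apply: (bigcap_sub_maximal maxM) => [i|]; first exact: ridealP.
  have -> : \bigcap_(i in [set` index_enum 'I_n]) A i = right_principal (a * b).
    by rewrite prodA; apply: eq_bigcapl; split=> // i _ /=; rewrite mem_index_enum.
  by apply: right_principal_sub => //; apply: MM.
have [s As Ms] : exists2 s, (\bigcap_(j in [set j | j != i]) A j) s & ~ M s.
  have: ideal_add (A i) (\bigcap_(j in [set j | j != i]) A j) 1 by rewrite coA.
  move=> [x Ax [s As E]]; exists s => // Ms.
  by apply: (maximal_ideal1 maxM); rewrite -E; apply: MD => //; apply: AiM.
have comp x y : M y -> right_principal (x * y) = right_principal (a * b) ->
    right_principal x `<=` ideal_add (right_principal y) (A i) ->
    exists s' c, ~ M s' /\ s' * x = y * c.
  move=> My Exy /(_ _ (@right_principal_id _ x)) [_ [t _ <-] [c Ac E]].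
  have [u _ Eu] : right_principal (x * y) (s * c).
    rewrite Exy prodA => j _; have [_ _ AM] := ridealP (A j).
    have [->|ji] := eqVneq j i.
      by rewrite mulrC; have [_ _] := ridealP (A i); apply.
    by apply: (AM); apply: As.
  exists (s - y * u), (s * t); split.
    move=> Msyu; apply: Ms; rewrite -(subrK (y * u) s).
    by apply: (MD) => //; apply: MM.
  rewrite mulrBl -{1}E mulrDr -Eu; ring.
have rad x : right_ideal (ideal_add (right_principal x) (A i)).
  by apply: ideal_add_right_ideal (ridealP _); apply: right_principal_right_ideal.
have [A0 _ _] := ridealP (A i).
have sub x : A i `<=` ideal_add (right_principal x) (A i).
  by apply: ideal_add_subr; have [] := right_principal_right_ideal x.
have subl x : right_principal x `<=` ideal_add (right_principal x) (A i).
  exact: ideal_add_subl.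
have /uniserial_right_quotP uAi := uA i.
have [ab|ba] := uAi _ _ (rad a) (rad b) (sub a) (sub b).
  have [s' [c [Ms' E]]] := comp a b Mb erefl (subset_trans (subl a) ab).
  by exists s', c; split=> //; left.
have [|s' [c [Ms' E]]] := comp b a Ma _ (subset_trans (subl b) ba).
  by rewrite mulrC.
by exists s', c; split=> //; right.
Qed.

Lemma right_principal_neq0 (x : R) : x != 0 -> right_principal x <> [set 0].
Proof.
move=> /eqP x0 E; apply: x0.
by have: right_principal x x by [exact: right_principal_id]; rewrite E.
Qed.

Lemma right_principal_ideal (x : R) : ideal (right_principal x).
Proof. by rewrite -right_idealE; apply: right_principal_right_ideal. Qed.

Lemma ideal_neq0 I : ideal I -> I <> [set 0] -> exists2 x, I x & x != 0.
Proof.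
move=> [[I0 _ _] _] IN0; apply: contrapT => noI; apply: IN0.
apply/seteqP; split=> [x Ix|_ ->//]; apply: contrapT => /eqP x0.
by apply: noI; exists x.
Qed.

Lemma serial_factorization_h_local :
  (forall I, ideal I -> I <> [set 0] -> has_serial_factorization I) ->
  h_local R.
Proof.
move=> fact.
have sR (x : R) : x != 0 -> has_serial_factorization (right_principal x).
  by move=> x0; apply: fact (right_principal_neq0 x0); apply: right_principal_ideal.
split=> [x x0|P primeP P0]; rewrite -maximal_right_idealE.
  exact/finite_maximal_right_ideals/sR.
have [iP _ _] := primeP; have [x Px x0] := ideal_neq0 iP P0.
exact: prime_unique_maximal_right_ideal (sR x x0) primeP Px.
Qed.

Lemma serial_factorization_prufer :
  (forall I, ideal I -> I <> [set 0] -> has_serial_factorization I) ->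
  prufer_domain R.
Proof.
move=> fact M maxM; apply/localization_valuation_domainP => // a b a0 b0.
have [Ma|Ma] := pselect (M a); last by exists a, b; split=> //; right;
  rewrite mulrC.
have [Mb|Mb] := pselect (M b); last by exists b, a; split=> //; left;
  rewrite mulrC.
apply: has_serial_factorization_localization => //.
by apply: fact (right_principal_neq0 (mulf_neq0 a0 b0)); apply: right_principal_ideal.
Qed.

(* The ideal I R_M of R_M, contracted to R. *)
Definition saturation M I : set R := [set x | exists2 s, ~ M s & I (s * x)].

Section Saturation.
Variables M I : set R.
Hypotheses (maxM : maximal_ideal M) (iI : ideal I).

Lemma saturation_right_ideal : right_ideal (saturation M I).
Proof.
have [[I0 ID IM] _] := iI; split.
- by exists 1; [apply: maximal_ideal1 | rewrite mulr0].
- move=> x y [s Ms Isx] [t Mt Ity]; exists (s * t).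
    exact: maximal_ideal_mul.
  rewrite mulrDr; apply: (ID); first by rewrite mulrAC; apply: (IM).
  by rewrite -mulrA mulrC; apply: (IM).
- by move=> x a [s Ms Isx]; exists s => //; rewrite mulrA; apply: (IM).
Qed.

Lemma sub_saturation : I `<=` saturation M I.
Proof. by move=> x Ix; exists 1; [apply: maximal_ideal1 | rewrite mul1r]. Qed.

Lemma saturation_sub : I `<=` M -> saturation M I `<=` M.
Proof.
move=> IM x [s Ms /IM Msx]; apply: contrapT => Mx.
exact: (maximal_ideal_mul maxM Ms Mx).
Qed.

(* Otherwise some prime containing I avoids every product of an element outside
   M by an element outside N, and so is contained in both M and N. *)
Lemma saturation_h_local N : h_local R -> maximal_ideal N -> I <> [set 0] ->
  saturation M I `<=` N -> N = M.
Proof.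
move=> [_ uniqR] maxN I0 satN.
pose S : set R := [set z | exists s t, [/\ ~ M s, ~ N t & z = s * t]].
have M1 := maximal_ideal1 maxM; have N1 := maximal_ideal1 maxN.
have [|||P [primeP IP PS]] := @exists_prime_ideal_avoiding _ I S iI.
- by exists 1, 1; split=> //; rewrite mulr1.
- move=> _ _ [s [t [Ms Nt ->]]] [s' [t' [Ms' Nt' ->]]].
  exists (s * s'), (t * t'); split; [| |by rewrite mulrACA].
    exact: maximal_ideal_mul.
  exact: maximal_ideal_mul.
- apply/seteqP; split=> // z [Iz [s [t [Ms Nt E]]]].
  by apply: Nt; apply: satN; exists s; rewrite // -E.
have PM : P `<=` M.
  move=> x Px; apply: contrapT => Mx; suff: (P `&` S) x by rewrite PS.
  by split=> //; exists x, 1; rewrite mulr1.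
have PN : P `<=` N.
  move=> x Px; apply: contrapT => Nx; suff: (P `&` S) x by rewrite PS.
  by split=> //; exists 1, x; rewrite mul1r.
have P0 : P <> [set 0].
  move=> P0; have [x Ix /eqP] := ideal_neq0 iI I0; apply.
  by have := IP x Ix; rewrite P0.
have [Q [_ uniqQ]] := uniqR P primeP P0.
by rewrite -(uniqQ N) // -(uniqQ M).
Qed.

Lemma saturation_comparable (hloc : h_local R) (I0 : I <> [set 0]) (x y s c : R) :
  ~ M s -> s * x = y * c ->
  ideal_add (saturation M I) (right_principal y) x.
Proof.
move=> Ms E; have rS := saturation_right_ideal.
have: ideal_add (saturation M I) (right_principal s) 1.
  rewrite comax_maximal //; first exact: right_principal_right_ideal.
  move=> N maxN satN sN; apply: Ms.
  rewrite -(saturation_h_local hloc maxN I0 satN).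
  exact/sN/right_principal_id.
move=> [u Su [_ [v _ <-] uv]]; exists (u * x); first by have [_ _] := rS; apply.
exists (y * c * v); first by exists (c * v); rewrite // mulrA.
by rewrite -E -[in RHS](mul1r x) -uv; ring.
Qed.

End Saturation.

Lemma h_local_prufer_serial_factorization I : h_local R -> prufer_domain R ->
  ideal I -> I <> [set 0] -> has_serial_factorization I.
Proof.
move=> hloc pru iI I0; have rI := iI.1.
have [x Ix x0] := ideal_neq0 iI I0.
have /finite_seqP[s Es] :
    finite_set [set M : set R | maximal_ideal M /\ I `<=` M].
  by apply: sub_finite_set (hloc.1 x x0) => M [maxM IM]; split=> //; apply: IM.
pose u := undup s; pose M (i : 'I_(size u)) := nth setT u i.
have memM i : maximal_ideal (M i) /\ I `<=` M i.
  suff: [set M : set R | maximal_ideal M /\ I `<=` M] (M i) by [].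
  by rewrite Es /= -mem_undup mem_nth.
have M_inj : injective M.
  move=> i j /eqP; rewrite nth_uniq ?undup_uniq // => /eqP; exact: val_inj.
have M_surj N : maximal_ideal N -> I `<=` N -> exists i, N = M i.
  move=> maxN IN; have : [set M : set R | maximal_ideal M /\ I `<=` M] N by [].
  rewrite Es /= -mem_undup => Nu; have lt_u : (index N u < size u)%N.
    by rewrite index_mem.
  by exists (Ordinal lt_u); rewrite /M nth_index.
pose A i := Rideal (saturation_right_ideal (memM i).1 iI).
have IA i : I `<=` A i by apply: sub_saturation; have [] := memM i.
have AM i : A i `<=` M i by apply: saturation_sub; have [] := memM i.
have A_uniq i N : maximal_ideal N -> A i `<=` N -> N = M i.
  by move=> maxN; apply: saturation_h_local => //; have [] := memM i.
have -> : I = \bigcap_i (A i : set R).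
  apply/seteqP; split=> [y Iy i _|y Ay]; first exact: IA.
  have [_ ID IM] := rI.
  have rC : right_ideal [set z | I (z * y)].
    split=> /= [|z t Iz It|z t Iz]; first by rewrite mul0r; have [] := rI.
      by rewrite mulrDl; apply: (ID).
    by rewrite mulrAC; apply: (IM).
  suff: ideal_add [set z | I (z * y)] [set z | I (z * y)] 1.
    by move=> [z Iz [t It E]]; rewrite -[y]mul1r -E mulrDl; apply: (ID).
  rewrite comax_maximal // => N maxN CN _.
  have [|i EN] := M_surj N maxN.
    by apply: subset_trans CN => z Iz /=; apply: (IM).
  have [//|t Mt Ity] := Ay i; apply: Mt.
  by rewrite -EN; apply: CN.
exists (size u), A; apply: bigcap_serial_factorization.
  split=> i.
    apply/(right_ideal_proper (ridealP _)) => /AM.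
    by apply: maximal_ideal1; have [] := memM i.
  apply: comax_maximal; [exact: ridealP| |].
    exact: bigcap_right_ideal (fun j => ridealP (A j)).
  move=> N maxN /(A_uniq _ _ maxN) ->.
  pose t := [seq j <- index_enum 'I_(size u) | j != i].
  have -> : [set j | j != i] = [set` t].
    by apply/seteqP; split=> j /=; rewrite mem_filter mem_index_enum andbT.
  move=> /(bigcap_sub_maximal (memM i).1 (fun j => ridealP (A j))) [j].
  rewrite mem_filter => /andP[/eqP ji _] /(A_uniq _ _ (memM i).1) /M_inj.
  by move/esym.
move=> i; apply/uniserial_right_quotP => J K rJ rK AJ AK.
apply: contrapT => /not_orP[/nonsubset[y [Jy Ky]] /nonsubset[z [Kz Jz]]].
have y0 : y != 0 by apply/eqP => y0; apply: Ky; rewrite y0; have [] := rK.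
have z0 : z != 0 by apply/eqP => z0; apply: Jz; rewrite z0; have [] := rJ.
have [maxMi _] := memM i.
have compA L v w c d : right_ideal L -> A i `<=` L -> L w -> ~ M i d ->
    d * v = w * c -> L v.
  move=> [_ LD LM] AL Lw Md E.
  have [a Aa [_ [b _ <-] <-]] := saturation_comparable maxMi iI hloc I0 Md E.
  by apply: (LD); [apply: AL | apply: LM].
have /(localization_valuation_domainP maxMi) := pru _ maxMi.
move=> /(_ y z y0 z0) [d [c [Md [E|E]]]].
  by apply: Ky; apply: compA E.
by apply: Jz; apply: compA E.
Qed.

End Domains.

Theorem proposition3p11 :
  (forall (R : nzRingType) (r : R),
     has_serial_factorization (right_principal r) ->
     finite_set [set M : set R | maximal_right_ideal M /\ M r] /\
     (forall P : set R, prime_ideal P -> P r ->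
        exists! M : set R, maximal_right_ideal M /\ P `<=` M)) /\
  (forall R : idomainType,
     (forall I : set R, ideal I -> I <> [set 0] ->
        has_serial_factorization I) <->
     (h_local R /\ prufer_domain R)).
Proof.
split=> [R r sr|R].
  split; first exact: finite_maximal_right_ideals.
  by move=> P; apply: prime_unique_maximal_right_ideal.
split=> [fact|[hloc pru] I]; last exact: h_local_prufer_serial_factorization.
by split; [apply: serial_factorization_h_local | apply: serial_factorization_prufer].
Qed.
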